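(* Let $k \ge 4$ be a fixed integer (independent of $n$). Then \[\mathrm{size}(\mathrm{THR}_n^k) \le \left(4.5-2^{\,2-\lceil \log_2 k\rceil}\right)n+o(n)\,,\] where $o(n)$ denotes a function of $n$ (which may depend on $k$) with $o(n)/n \to 0$ as $n\to\infty$.
   Context: A Boolean straight line program of size $s$ on input variables $x_1,\dots,x_n$ is a sequence of $s$ instructions, each of the form $g \gets h \circ k$ where $\circ$ is an arbitrary binary Boolean operation (any of the 16 functions $\{0,1\}^2\to\{0,1\}$) and each operand is either an input variable or the result of an earlier instruction; designated instructions are outputs, and the program computes a function in the natural way (equivalently, a Boolean circuit with fan-in-two gates over the full binary basis). For a Boolean function $f$, $\mathrm{size}(f)$ is the minimum size of a straight line program computing $f$. The threshold function $\mathrm{THR}_n^k\colon\{0,1\}^n\to\{0,1\}$ is defined by $\mathrm{THR}_n^k(x_1,\dots,x_n)=1$ if $x_1+\dots+x_n\ge k$ and $0$ otherwise. *)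

(* Defs.v *)
From mathcomp Require Import all_boot all_order all_algebra.
Set Implicit Arguments. Unset Strict Implicit. Unset Printing Implicit Defensive.
Import Order.TTheory GRing.Theory Num.Theory.

(* An instruction g <- h o k : an arbitrary binary Boolean operation
   (every function bool -> bool -> bool, i.e. all 16 of them) and two operand
   wires.  Wires are numbered: 0..n-1 are the inputs x_1..x_n, and wire n+i is
   the result of instruction i (0-based). *)
Record instr := Instr { op : bool -> bool -> bool; arg1 : nat; arg2 : nat }.

Record slp := SLP { instrs : seq instr; out : nat }.

Definition slp_size (P : slp) : nat := size (instrs P).

Definition slp_wf (n : nat) (P : slp) : Prop :=
  (forall i, i < size (instrs P) ->
     arg1 (nth (Instr (fun _ _ => false) 0 0) (instrs P) i) < n + i /\
     arg2 (nth (Instr (fun _ _ => false) 0 0) (instrs P) i) < n + i) /\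
  out P < n + size (instrs P).

Definition wires (n : nat) (P : slp) (x : 'I_n -> bool) : seq bool :=
  foldl (fun w (g : instr) => rcons w (op g (nth false w (arg1 g)) (nth false w (arg2 g))))
        [seq x i | i <- enum 'I_n] (instrs P).

Definition slp_eval (n : nat) (P : slp) (x : 'I_n -> bool) : bool :=
  nth false (wires P x) (out P).

Definition slp_computes (n : nat) (P : slp) (f : ('I_n -> bool) -> bool) : Prop :=
  slp_wf n P /\ forall x, slp_eval P x = f x.

Definition size_le (n : nat) (f : ('I_n -> bool) -> bool) (s : nat) : Prop :=
  exists P : slp, slp_computes P f /\ slp_size P <= s.

Definition THR (n k : nat) (x : 'I_n -> bool) : bool := k <= \sum_(i < n) (x i : nat).
Arguments THR : clear implicits.

(* Main.v *)
(* Let [2^h < k <= 2^h.+1].  The input is grouped into pairs of bits [a, b] given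
   as [a] and [a (+) b]; a chain of double full adders, 8 gates each, turns [2 L]
   pairs of weight [w] into one bit of weight [w] and [L] pairs of weight [2 w].
   After [h] such levels the input sum is [R + 2^h t] with [R < 2^h] given by
   [h] bits and [t] the sum of the remaining [M = n / 2^h.+1] pairs, so it is at
   least [k] iff [t >= 2], or [t >= 1] and [R >= k - 2^h].  Comparing [t] with 1
   and 2 takes [4 M + O(sqrt M)] gates, for a total of [M (9 * 2^h - 4) + o(n)].
   Zero padding makes [M] a perfect square at the cost of [O(sqrt n)] inputs. *)
Require Import Defs.
From Stdlib Require List.
From mathcomp Require Import all_boot all_order all_algebra.
From mathcomp Require Import zify ring.
Import Order.TTheory GRing.Theory Num.Theory.

(** * Programs viewed through the functions they compute *)

Definition bfun (n : nat) := ('I_n -> bool) -> bool.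

(** The output wire is existential, so one instruction list computes many functions at once and
    gates can be shared. *)
Definition computes {n : nat} (P : seq instr) (f : bfun n) : Prop :=
  exists w, slp_computes (SLP P w) f.

(** Semantic rather than syntactic extension: wire numbers stay hidden when subcircuits are
    composed. *)
Definition extends (n s : nat) (P Q : seq instr) : Prop :=
  size Q <= size P + s /\ forall f : bfun n, computes P f -> computes Q f.

Lemma extends_refl {n P} : extends n 0 P P.
Proof. by split; rewrite ?addn0. Qed.

Lemma extends_trans {n s t P Q R} :
  extends n s P Q -> extends n t Q R -> extends n (s + t) P R.
Proof.
move=> [sPQ PQ] [sQR QR]; split; last by move=> f /PQ /QR.
by rewrite addnA (leq_trans sQR) // leq_add2r.
Qed.

Lemma extends_leq {n s t P Q} : s <= t -> extends n s P Q -> extends n t P Q.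
Proof.
by move=> le_st [sQ PQ]; split=> //; apply: leq_trans sQ _; rewrite leq_add2l.
Qed.

Lemma computes_all_extends {n s P Q} {fs : seq (bfun n)} :
  extends n s P Q -> List.Forall (computes P) fs -> List.Forall (computes Q) fs.
Proof. by case=> _ PQ; apply: List.Forall_impl. Qed.

Lemma size_wires {n} (P : slp) (x : 'I_n -> bool) :
  size (wires P x) = n + slp_size P.
Proof.
case: P => P o; rewrite /wires /slp_size /=.
elim/last_ind: P => [|P g IH]; first by rewrite /= size_map size_enum_ord addn0.
by rewrite foldl_rcons !size_rcons IH addnS.
Qed.

Lemma computes_input {n} (i : 'I_n) : computes [::] (fun x : 'I_n -> bool => x i).
Proof.
exists i; split; first by split=> //=; rewrite addn0.
move=> x; rewrite /slp_eval /wires /=.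
by rewrite (nth_map i) ?size_enum_ord // nth_ord_enum.
Qed.

Lemma computes_ext {n P} {f g : bfun n} : f =1 g -> computes P f -> computes P g.
Proof. by move=> fg [w [wP Pf]]; exists w; split=> // x; rewrite -fg. Qed.

Lemma gate {n P} (o : bool -> bool -> bool) {f g : bfun n} :
  computes P f -> computes P g ->
  exists Q, extends n 1 P Q /\ computes Q (fun x => o (f x) (g x)).
Proof.
move=> [u [[wfP /= lu] Pf]] [v [[_ /= lv] Pg]].
pose Q := rcons P (Instr o u v).
have wires_Q w w' x : wires (SLP Q w) x =
    rcons (wires (SLP P w') x) (o (f x) (g x)).
  by rewrite /wires /= foldl_rcons -Pf -Pg.
have wfQ i : i < size Q ->
    arg1 (nth (Instr (fun _ _ => false) 0 0) Q i) < n + i /\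
    arg2 (nth (Instr (fun _ _ => false) 0 0) Q i) < n + i.
  rewrite /Q size_rcons ltnS leq_eqVlt nth_rcons => /orP[/eqP ->|lt_i].
    by rewrite ltnn eqxx.
  by rewrite lt_i; apply: wfP.
exists Q; split; first split; first by rewrite size_rcons addn1.
  move=> h [w [[_ /= lw] Ph]]; exists w; split; first split=> //=.
    by rewrite size_rcons addnS ltnS ltnW.
  by move=> x; rewrite -Ph /slp_eval (wires_Q _ w) nth_rcons size_wires lw.
exists (n + size P); split; first by split=> //=; rewrite size_rcons addnS.
move=> x; rewrite /slp_eval (wires_Q _ u) nth_rcons size_wires.
by rewrite /slp_size /= ltnn eqxx.
Qed.

Ltac lift E :=
  match type of E with extends _ _ ?P _ =>
    repeat match goal with
    | H : computes P _ |- _ => apply (proj2 E) in H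
    | H : List.Forall (computes P) _ |- _ => apply (computes_all_extends E) in H
    end
  end.

Ltac add_gate o Hf Hg E H :=
  let Q := fresh "Q" in have [Q [E H]] := gate o Hf Hg; lift E.

(** * General-purpose subcircuits *)

Lemma computes_or {n P} {z : bfun n} {fs : seq (bfun n)} :
  computes P z -> List.Forall (computes P) fs ->
  exists Q, extends n (size fs) P Q /\
    computes Q (fun x => z x || has (fun f : bfun n => f x) fs).
Proof.
elim: fs P z => [|f fs IH] P z Pz Pfs.
  exists P; split; first exact: extends_refl.
  by apply: computes_ext Pz => x /=; rewrite orbF.
move/List.Forall_cons_iff: Pfs => [Pf Pfs].
add_gate orb Pz Pf E1 H1.
have [R [E2 H2]] := IH _ _ H1 Pfs.
exists R; split; first by apply: (extends_trans E1 E2).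
by apply: computes_ext H2 => x /=; rewrite orbA.
Qed.

Lemma computes_mux {n P} {c u v : bfun n} :
  computes P c -> computes P u -> computes P v ->
  exists Q, extends n 3 P Q /\ computes Q (fun x => if c x then u x else v x).
Proof.
move=> Pc Pu Pv.
add_gate andb Pc Pu E1 H1.
add_gate (fun a b => ~~ a && b) Pc Pv E2 H2.
add_gate orb H1 H2 E3 H3.
exists Q1; split; first exact: extends_trans (extends_trans E1 E2) E3.
by apply: computes_ext H3 => x /=; case: (c x); rewrite /= ?orbF.
Qed.

(** Shannon expansion on the first function: the cost satisfies T(0) = 1 and T(m+1) = 2 T(m) + 3. It
    is exponential in [size fs], but will be applied to a number of bits depending only on k. *)
Lemma computes_any {n P} {z : bfun n} {fs : seq (bfun n)} (G : seq bool -> bool) :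
  computes P z -> List.Forall (computes P) fs ->
  exists Q, extends n (2 ^ (size fs).+2 - 3) P Q /\
    computes Q (fun x => G [seq f x | f : bfun n <- fs]).
Proof.
elim: fs P G => [|f fs IH] P G Pz Pfs.
  by add_gate (fun _ _ : bool => G [::]) Pz Pz E H; exists Q.
move/List.Forall_cons_iff: Pfs => [Pf Pfs].
have [Q1 [E1 H1]] := IH P (fun s => G (true :: s)) Pz Pfs; lift E1.
have [Q2 [E2 H2]] := IH Q1 (fun s => G (false :: s)) Pz Pfs; lift E2.
have [Q3 [E3 H3]] := computes_mux Pf H1 H2.
exists Q3; split; last by apply: computes_ext H3 => x /=; case: (f x).
apply: extends_leq (extends_trans (extends_trans E1 E2) E3).
by have := expn_gt0 2 (size fs); rewrite /= !expnS; lia.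
Qed.

(* Starting from [s = o = false], [o] records whether two of the scanned values are true. *)
Lemma computes_scan {n P} {s o : bfun n} {fs : seq (bfun n)} :
  computes P s -> computes P o -> List.Forall (computes P) fs ->
  exists Q, [/\ extends n (3 * size fs) P Q,
    computes Q (fun x => s x || (0 < \sum_(f <- fs) (f x : nat))) &
    computes Q (fun x => o x || (1 < s x + \sum_(f <- fs) (f x : nat)))].
Proof.
elim: fs P s o => [|f fs IH] P s o Ps Po Pfs.
  exists P; split; first by rewrite muln0; exact: extends_refl.
    by apply: computes_ext Ps => x; rewrite big_nil orbF.
  by apply: computes_ext Po => x; rewrite big_nil; case: (s x); rewrite orbF.
move/List.Forall_cons_iff: Pfs => [Pf Pfs].
add_gate andb Ps Pf E1 H1.
add_gate orb Po H1 E2 H2.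
add_gate orb Ps Pf E3 H3.
have [R [E4 H4 H5]] := IH _ _ _ H3 H2 Pfs.
exists R; split.
- apply: extends_leq (extends_trans (extends_trans (extends_trans E1 E2) E3) E4).
  by rewrite /=; lia.
- apply: computes_ext H4 => x; rewrite big_cons.
  by case: (s x); case: (f x).
- apply: computes_ext H5 => x; rewrite big_cons.
  by case: (s x); case: (f x); case: (o x); rewrite //= ?add0n ?add1n ?orbF.
Qed.

(** * Pairs of bits and double full adders *)

(* A pair [p] stands for the two bits [a = p.1] and [b = p.1 (+) p.2]: the second
   component is [a (+) b]. *)
Definition pair_sum {n} (ps : seq (bfun n * bfun n)) (x : 'I_n -> bool) : nat :=
  \sum_(p <- ps) ((p.1 x : nat) + (p.1 x (+) p.2 x : nat)).

Lemma computes_pairing {n P} {fs : seq (bfun n)} {L : nat} :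
  size fs = L.*2 -> List.Forall (computes P) fs ->
  exists Q ps, [/\ extends n L P Q,
    size ps = L, List.Forall (computes Q) (unzip1 ps),
    List.Forall (computes Q) (unzip2 ps) &
    forall x, pair_sum ps x = \sum_(f <- fs) (f x : nat)].
Proof.
elim: L P fs => [|L IH] P [|a [|b fs]] //=.
  move=> _ _; exists P, [::]; split=> //; first exact: extends_refl.
  by move=> x; rewrite /pair_sum !big_nil.
case=> sz /List.Forall_cons_iff[Pa /List.Forall_cons_iff[Pb Pfs]].
have [Q [ps [E1 sps H1 H2 Hsum]]] := IH _ _ sz Pfs; lift E1.
add_gate addb Pa Pb E2 H3.
exists Q0, ((a, fun x => a x (+) b x) :: ps); split; rewrite /= ?sps //.
- by rewrite -addn1; apply: extends_trans E1 E2.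
- by constructor.
- by constructor.
move=> x; move: (Hsum x); rewrite /pair_sum !big_cons => -> /=.
by rewrite addKb addnA.
Qed.

(* Two consecutive full adders on [z + a1 + b1] and on the result [t] plus
   [a2 + b2], whose carries are output as one pair.  The gate [u] equals
   [carry1 (+) t], which saves a gate in the computation of both output
   components. *)
Lemma computes_double_adder {n P} {z a1 c1 a2 c2 : bfun n} :
  computes P z -> computes P a1 -> computes P c1 -> computes P a2 ->
  computes P c2 ->
  exists Q s a c, [/\ extends n 8 P Q,
    computes Q s, computes Q a, computes Q c &
    forall x, z x + (a1 x + (a1 x (+) c1 x)) + (a2 x + (a2 x (+) c2 x)) =
              s x + 2 * (a x + (a x (+) c x)) :> nat].
Proof.
move=> Hz Ha1 Hc1 Ha2 Hc2.
add_gate addb Ha1 Hz E1 H1.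
add_gate orb Hc1 H1 E2 Hu.
add_gate addb Hz Hc1 E3 Ht.
add_gate addb Hu Ht E4 Ha.
add_gate addb Ha2 Ht E5 H5.
add_gate (fun g c => g && ~~ c) H5 Hc2 E6 H6.
(* The second carry is [t] xor the gate of [H6], so [t] cancels here and the xor of the two carries
   remains. *)
add_gate addb Hu H6 E7 Hc.
add_gate addb Ht Hc2 E8 Hs.
eexists _, _, _, _; split; [|exact: Hs|exact: Ha|exact: Hc|].
  have E12 := extends_trans E1 E2; have E34 := extends_trans E3 E4.
  have E56 := extends_trans E5 E6; have E78 := extends_trans E7 E8.
  exact: extends_trans (extends_trans E12 E34) (extends_trans E56 E78).
move=> x /=.
by case: (z x); case: (a1 x); case: (c1 x); case: (a2 x); case: (c2 x).
Qed.

(** The sum bit of each double adder is the incoming bit [z] of the next one. *)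
Lemma computes_adder_chain {n P} {z : bfun n} {ps : seq (bfun n * bfun n)} {L : nat} :
  size ps = L.*2 -> computes P z ->
  List.Forall (computes P) (unzip1 ps) -> List.Forall (computes P) (unzip2 ps) ->
  exists Q s qs, [/\ extends n (8 * L) P Q, computes Q s /\ size qs = L,
    List.Forall (computes Q) (unzip1 qs), List.Forall (computes Q) (unzip2 qs) &
    forall x, z x + pair_sum ps x = s x + 2 * pair_sum qs x].
Proof.
elim: L P z ps => [|L IH] P z [|[a1 c1] [|[a2 c2] ps]] //=.
  move=> _ Pz _ _; exists P, z, [::]; split=> //; first exact: extends_refl.
  by move=> x; rewrite /pair_sum !big_nil.
case=> sz Pz /List.Forall_cons_iff[Pa1 /List.Forall_cons_iff[Pa2 Pas]].
move=> /List.Forall_cons_iff[Pc1 /List.Forall_cons_iff[Pc2 Pcs]].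
have [Q [s [a [c [E1 Ps Pa Pc eq1]]]]] := computes_double_adder Pz Pa1 Pc1 Pa2 Pc2.
lift E1.
have [R [s' [qs [E2 [Ps' sqs] H1 H2 eq2]]]] := IH _ _ _ sz Ps Pas Pcs.
lift E2.
exists R, s', ((a, c) :: qs); split; rewrite /= ?sqs //.
- by rewrite mulnS; apply: extends_trans E1 E2.
- by constructor.
- by constructor.
move=> x; move: (eq1 x) (eq2 x); rewrite /pair_sum !big_cons /=.
lia.
Qed.

(** * Binary digits of the input sum *)

Definition binary_value (bs : seq bool) : nat :=
  foldr (fun (b : bool) v => b + 2 * v) 0 bs.

Lemma binary_value_lt (bs : seq bool) : binary_value bs < 2 ^ size bs.
Proof. by elim: bs => //= b bs IH; rewrite expnS; case: b => /=; lia. Qed.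

(** Each level emits one digit, least significant first, and halves the number of pairs; the costs 8
    M 2^(h-1), ..., 8 M form a geometric sum. *)
Lemma computes_low_bits {n P} {z : bfun n} {ps : seq (bfun n * bfun n)} {h M : nat} :
  size ps = M * 2 ^ h -> computes P z -> (forall x, z x = false) ->
  List.Forall (computes P) (unzip1 ps) -> List.Forall (computes P) (unzip2 ps) ->
  exists Q rs qs, [/\ extends n (8 * (M * (2 ^ h - 1))) P Q,
    size rs = h /\ size qs = M, List.Forall (computes Q) rs,
    List.Forall (computes Q) (unzip1 qs) /\ List.Forall (computes Q) (unzip2 qs) &
    forall x, pair_sum ps x =
      binary_value [seq r x | r : bfun n <- rs] + 2 ^ h * pair_sum qs x].
Proof.
elim: h P ps => [|h IH] P ps sz Pz z0 Pas Pcs.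
  exists P, [::], ps; split=> //; first by rewrite subnn !muln0; exact: extends_refl.
    by rewrite sz muln1.
  by move=> x; rewrite mul1n.
have sz2 : size ps = (M * 2 ^ h).*2 by rewrite sz expnS; lia.
have [Q [s [qs [E1 [Qs sqs] Qas Qcs eq1]]]] := computes_adder_chain sz2 Pz Pas Pcs.
lift E1.
have [R [rs [qs' [E2 [srs sqs'] Rrs [Ras Rcs] eq2]]]] := IH _ _ sqs Pz z0 Qas Qcs.
lift E2.
exists R, (s :: rs), qs'; split=> //=; [| by rewrite srs | by constructor | ].
  apply: extends_leq (extends_trans E1 E2).
  by rewrite expnS; have := expn_gt0 2 h; rewrite /=; nia.
by move=> x; move: (eq1 x); rewrite z0 add0n eq2 => ->; rewrite expnS; lia.
Qed.

(** * Comparing a sum with 1 and 2 *)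

Lemma Forall_mkseq {A} {p : A -> Prop} {F : nat -> A} {q : nat} :
  (forall i, i < q -> p (F i)) -> List.Forall p (mkseq F q).
Proof.
elim: q F => [|q IH] F pF; first by constructor.
rewrite /mkseq /= -[1]/(1 + 0) iotaDl -map_comp.
by constructor; [apply: pF | apply: IH => i lt_i; apply: pF].
Qed.

Lemma Forall_nth {A} {p : A -> Prop} {s : seq A} (z : A) {i : nat} :
  List.Forall p s -> i < size s -> p (nth z s i).
Proof.
by elim: s i => [|a s IH] [|i] //= /List.Forall_cons_iff[pa ps] //; apply: IH.
Qed.

Lemma computes_grid_or {n P} {z : bfun n} {p : nat -> nat -> bfun n} {m q : nat} :
  computes P z -> (forall x, z x = false) ->
  (forall i j, i < m -> j < q -> computes P (p i j)) ->
  exists Q, extends n (m * q) P Q /\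
    forall i, i < m -> computes Q (fun x => has (fun j => p i j x) (iota 0 q)).
Proof.
move=> Pz z0; elim: m => [|m IH] Pp; first by exists P; split=> //; apply: extends_refl.
have [|Q [E1 H1]] := IH; first by move=> i j /ltnW; apply: Pp.
have Qz := E1.2 _ Pz.
have [|R [E2 H2]] := computes_or (fs := mkseq (p m) q) Qz.
  by apply: Forall_mkseq => j lt_jq; apply/E1.2/Pp.
rewrite size_mkseq in E2.
exists R; split; first by rewrite mulSnr; apply: extends_trans E1 E2.
move=> i; rewrite ltnS leq_eqVlt => /orP[/eqP -> | lt_im]; last exact/E2.2/H1.
by apply: computes_ext H2 => x; rewrite z0 has_map.
Qed.

(** A true cell lies where a nonempty row meets a nonempty column, hence [s <= r * c]. So [s >= 2]
    forces [r >= 2] or [c >= 2], and the other two bounds give the converse. *)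
Lemma grid_count (q : nat) (g : nat -> nat -> bool)
    (s := \sum_(0 <= i < q) \sum_(0 <= j < q) (g i j : nat))
    (r := \sum_(0 <= i < q) (has (g i) (iota 0 q) : nat))
    (c := \sum_(0 <= j < q) (has (g^~ j) (iota 0 q) : nat)) :
  [/\ r <= s, c <= s & s <= r * c].
Proof.
have has_le (p : pred nat) : has p (iota 0 q) <= \sum_(0 <= j < q) (p j : nat).
  case: hasP => // -[j]; rewrite mem_iota => lt_jq pj.
  by rewrite big_mkord (bigD1 (Ordinal (lt_jq : j < q))) //= pj.
split; first by apply: leq_sum => i _; apply: has_le.
  by rewrite /s exchange_big /=; apply: leq_sum => j _; apply: has_le.
rewrite /r /c /s [in leqRHS]big_mkord big_distrl big_mkord /=.
apply: leq_sum => i _; rewrite !big_mkord big_distrr /=; apply: leq_sum => j _.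
case gij: (g i j) => //.
have ->: has (g i) (iota 0 q) by apply/hasP; exists (j : nat); rewrite ?mem_iota ?add0n /=.
by have ->: has (g^~ j) (iota 0 q) by apply/hasP; exists (i : nat); rewrite ?mem_iota ?add0n /=.
Qed.

(* Place the bits in a [q] by [q] grid: two of them are true iff two rows or two
   columns contain a true bit. *)
Lemma computes_two {n P} {z : bfun n} {fs : seq (bfun n)} {q : nat} :
  computes P z -> (forall x, z x = false) -> size fs = q * q ->
  List.Forall (computes P) fs ->
  exists Q, [/\ extends n (2 * (q * q) + 6 * q + 1) P Q,
    computes Q (fun x => 0 < \sum_(f <- fs) (f x : nat)) &
    computes Q (fun x => 1 < \sum_(f <- fs) (f x : nat))].
Proof.
move=> Pz z0 sz Pfs.
pose p i j := nth z fs (i * q + j).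
have Pp i j : i < q -> j < q -> computes P (p i j).
  by move=> lt_iq lt_jq; apply: (Forall_nth z Pfs); rewrite sz; nia.
have [Q1 [E1 H1]] := computes_grid_or Pz z0 Pp.
have [|Q2 [E2 H2]] := computes_grid_or (p := fun j i => p i j) (m := q) (q := q)
  (E1.2 _ Pz) z0.
  by move=> j i lt_jq lt_iq; apply/E1.2/Pp.
lift E1; lift E2.
have [|Q3 [E3 Rany Rtwo]] := computes_scan (fs := mkseq
  (fun i (x : 'I_n -> bool) => has (fun j => p i j x) (iota 0 q)) q) Pz Pz.
  by apply: Forall_mkseq => i lt_iq; apply/E2.2/H1.
lift E3.
have [|Q4 [E4 _ Ctwo]] := computes_scan (fs := mkseq
  (fun j (x : 'I_n -> bool) => has (fun i => p i j x) (iota 0 q)) q) Pz Pz.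
  by apply: Forall_mkseq => j lt_jq; apply/E3.2/H2.
lift E4.
add_gate orb Rtwo Ctwo E5 Htwo; lift E5.
have sumE x : \sum_(f <- fs) (f x : nat) =
    \sum_(0 <= i < q) \sum_(0 <= j < q) (p i j x : nat).
  rewrite (big_nth z) sz big_nat_mul; apply: eq_bigr => i _.
  rewrite -{1}[i * q]add0n big_addn mulSnr addKn.
  by apply: eq_bigr => j _; rewrite addnC.
exists Q; split.
(* Row and column disjunctions cost [q * q] each, the scans [3 * q] each, the last [orb] one
   gate. *)
- rewrite !size_mkseq in E3 E4.
  apply: extends_leq (extends_trans (extends_trans (extends_trans
    (extends_trans E1 E2) E3) E4) E5).
  lia.
- apply: computes_ext Rany => x; rewrite z0 sumE big_map /=.
  have [] := grid_count q (fun i j => p i j x); rewrite /index_iota subn0; lia.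
- apply: computes_ext Htwo => x; rewrite z0 sumE !big_map /= !add0n.
  have [] := grid_count q (fun i j => p i j x); rewrite /index_iota subn0; nia.
Qed.

(** As [p.2] is a (+) b, the disjunction [p.1 || p.2] equals a || b: it tells whether the pair is
    nonzero. *)
Lemma computes_pair_or {n P} {ps : seq (bfun n * bfun n)} :
  List.Forall (computes P) (unzip1 ps) -> List.Forall (computes P) (unzip2 ps) ->
  exists Q, extends n (size ps) P Q /\
    List.Forall (computes Q) [seq (fun x => p.1 x || p.2 x) | p <- ps].
Proof.
elim: ps P => [|[a c] ps IH] P /=.
  by exists P; split=> //; apply: extends_refl.
move=> /List.Forall_cons_iff[Pa Pas] /List.Forall_cons_iff[Pc Pcs].
have [Q [E1 H1]] := IH _ Pas Pcs; lift E1.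
add_gate orb Pa Pc E2 H2.
by exists Q0; split; [rewrite -addn1; apply: extends_trans E1 E2 | constructor].
Qed.

(* Let [s] be the number of nonzero pairs and [d] the number of pairs with sum 1.
   The total [2 s - d], with [d <= s], is at least 2 iff [s >= 2], or [s >= 1] and [d = 0]. *)
Lemma computes_pairs_two {n P} {z : bfun n} {ps : seq (bfun n * bfun n)} {q : nat} :
  computes P z -> (forall x, z x = false) -> size ps = q * q ->
  List.Forall (computes P) (unzip1 ps) -> List.Forall (computes P) (unzip2 ps) ->
  exists Q, [/\ extends n (4 * (q * q) + 6 * q + 3) P Q,
    computes Q (fun x => 0 < pair_sum ps x) &
    computes Q (fun x => 1 < pair_sum ps x)].
Proof.
move=> Pz z0 sz Pas Pcs.
have [Q1 [E1 Hors]] := computes_pair_or Pas Pcs; lift E1.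
(* A pair has sum 1 iff its second component is true, so this disjunction tests d > 0. *)
have [Q2 [E2 Hodd]] := computes_or Pz Pcs; lift E2.
have szp : size [seq (fun x => p.1 x || p.2 x) | p <- ps] = q * q.
  by rewrite size_map.
have [Q3 [E3 Hany Htwo]] := computes_two Pz z0 szp Hors; lift E3.
add_gate (fun a b => a && ~~ b) Hany Hodd E4 Heven.
add_gate orb Htwo Heven E5 Hout.
have sums x : exists d, [/\ pair_sum ps x + d = 2 * \sum_(p <- ps) (p.1 x || p.2 x : nat),
    has (fun f : bfun n => f x) (unzip2 ps) = (0 < d) &
    d <= \sum_(p <- ps) (p.1 x || p.2 x : nat)].
  rewrite /pair_sum; elim: {sz Pas Pcs E1 Hors E2 Hodd szp E3 Hany Htwo Heven Hout} ps.
    by exists 0; rewrite !big_nil.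
  move=> [a c] ps [d [eq_d has_d le_d]]; exists (c x + d); rewrite !big_cons /= has_d.
  by split; case: (a x); case: (c x) => /=; lia.
exists Q0; split.
- rewrite size_map sz in E2; rewrite sz in E1.
  apply: extends_leq (extends_trans (extends_trans (extends_trans
    (extends_trans E1 E2) E3) E4) E5).
  lia.
- apply: computes_ext Hany => x; rewrite big_map.
  have [d [+ _ +]] := sums x; set S := \sum_(p <- ps) _.
  by lia.
- apply: computes_ext Hout => x; rewrite big_map z0 /=.
  have [d [+ -> +]] := sums x; set S := \sum_(p <- ps) _.
  by lia.
Qed.

(** * The threshold circuit and its gate count *)

Lemma size_THR {n k h q : nat} :
  0 < n -> n <= q * q * 2 ^ h.+1 -> 2 ^ h < k <= 2 ^ h.+1 ->
  size_le (THR n k) (q * q * (9 * 2 ^ h - 4) + 6 * q + 2 ^ h.+2 + 3).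
Proof.
move=> n_gt0 le_n /andP[lt_k le_k].
pose x0 := computes_input (Ordinal n_gt0).
(* The constant false, used for padding and initial carries, needs some wire as operand; [n_gt0]
   provides one. *)
have [P [E0 Pz]] := gate (fun _ _ => false) x0 x0.
set z := (fun _ => false) in Pz.
have z0 x : z x = false by [].
pose fs : seq (bfun n) := [seq (fun x => x i) | i <- enum 'I_n] ++
  nseq (q * q * 2 ^ h.+1 - n) z.
have sz_fs : size fs = (q * q * 2 ^ h).*2.
  by rewrite size_cat size_map size_enum_ord size_nseq subnKC // expnS; lia.
have Pfs : List.Forall (computes P) fs.
  rewrite /fs; elim: (enum 'I_n) => [|i s IH] /=.
    by elim: (_ - n) => [|m IH]; constructor.
  by constructor; first exact/E0.2/computes_input.
have sum_fs x : \sum_(f <- fs) (f x : nat) = \sum_(i < n) (x i : nat).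
  rewrite big_cat big_map big_enum /= [X in _ + X](_ : _ = 0) ?addn0 //.
  by elim: (_ - n) => [|m IH]; rewrite ?big_nil // big_cons IH.
have [Q1 [ps [E1 sz_ps H1 H2 sum_ps]]] := computes_pairing sz_fs Pfs; lift E1.
have [Q2 [rs [qs [E2 [sz_rs sz_qs] Hrs [Has Hcs] sum_qs]]]] :=
  computes_low_bits sz_ps Pz z0 H1 H2; lift E2.
have [Q3 [E3 Hany Htwo]] := computes_pairs_two Pz z0 sz_qs Has Hcs; lift E3.
have [Q4 [E4 Hlow]] :=
  computes_any (fun s => k - 2 ^ h <= binary_value s) Pz Hrs; lift E4.
add_gate andb Hany Hlow E5 H5.
add_gate orb Htwo H5 E6 H6; case: H6 => w [wf_w eval_w].
have [size_Q _] := extends_trans (extends_trans (extends_trans (extends_trans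
  (extends_trans (extends_trans E0 E1) E2) E3) E4) E5) E6.
exists (SLP Q0 w); split; last first.
  (* With M = [q * q]: 1 for [z], M 2^h for pairing, 8 M (2^h - 1) for the adders, 4 M + 6 q + 3 for
     the comparisons, 2^(h+2) - 3 for the test on R, and 2 final gates. *)
  rewrite /slp_size /= (leq_trans size_Q) // sz_rs !expnS.
  have := expn_gt0 2 h; case: (2 ^ h) => // a _.
  move: (q * q) => M.
  rewrite subn1 /=.
  nia.
split=> // x; rewrite eval_w /THR -sum_fs -sum_ps sum_qs.
have := binary_value_lt [seq f x | f : bfun n <- rs]; rewrite size_map sz_rs.
move: lt_k le_k; rewrite expnS.
(* For t = 0 the sum is below 2^h < k; for t >= 2 it is at least 2^(h+1) >= k; only t = 1 depends on
   R. *)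
case: (pair_sum qs x) => [|[|t]] /=; nia.
Qed.

(** * Choice of the grid side and asymptotics *)

Lemma grid_side (c : nat) : 0 < c -> exists q : nat -> nat, forall n,
  n <= q n * q n * c /\ (q n).-1 * (q n).-1 * c <= n.
Proof.
move=> c_gt0.
have ex_q n : exists q, n <= q * q * c by exists n; nia.
(* The least admissible side: minimality makes its predecessor too small, which bounds the
   padding. *)
exists (fun n => ex_minn (ex_q n)) => n; case: ex_minnP => q le_n min_q; split=> //.
case: q min_q {le_n} => //= q min_q; rewrite leqNgt; apply/negP => lt_n.
by have := min_q q (ltnW lt_n); rewrite ltnn.
Qed.

(** Shows that a multiple of sqrt n is eventually below n: if r > 3 F then r^2 dominates F (r + 2),
    otherwise the explicit threshold does. *)
Lemma linear_le_square (F r n : nat) :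
  9 * (F * F) + 3 * F <= n -> r * r <= n -> F * (r + 2) <= n.
Proof.
move=> le_N le_r; have [le_rF | lt_Fr] := leqP r (3 * F); first by nia.
by apply: leq_trans le_r; nia.
Qed.

Local Open Scope ring_scope.

(* up_log 2 k = ceil(log2 k).  The o(n) term is a function g of n (it may
   depend on k) with g(n)/n -> 0. *)
Theorem theorem2 (k : nat) (hk : (4 <= k)%N) :
  exists g : nat -> rat,
    (forall eps : rat, 0 < eps ->
       exists N : nat, forall n : nat, (N <= n)%N -> `|g n| <= eps * n%:R) /\
    (forall n : nat, (0 < n)%N ->
       exists s : nat, size_le (THR n k) s /\
         s%:R <= (9%:R / 2%:R - 2%:R ^- (up_log 2 k) * 4%:R) * n%:R + g n).
Proof.
have k_gt1 : (1 < k)%N by apply: leq_trans hk.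
have /= := up_log_bounds (isT : (1 < 2)%N) k_gt1.
have : (0 < up_log 2 k)%N by rewrite up_log_gt0.
case: (up_log 2 k) => // h _ /= bounds_k.
have [q q_spec] := @grid_side (2 ^ h.+1) (expn_gt0 2 _).
(* With r = q - 1, [D * (r + 2)] absorbs (2 r + 1) (9 a - 4) + 6 (r + 1) + 4 a + 3, the excess over
   r^2 (9 a - 4). *)
pose a := (2 ^ h)%N; pose D := (22 * a + 9)%N.
have a_gt0 : (0 < a)%N by rewrite expn_gt0.
exists (fun n => (D * (q n).+1)%:R); split=> [eps eps_gt0 | n n_gt0].
  pose E := Num.bound eps^-1.
  have E_gt : eps^-1 < E%:R by apply: archi_boundP; rewrite invr_ge0 ltW.
  pose F := (D * E)%N; exists (9 * (F * F) + 3 * F)%N => n le_n.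
  have [_ le_q] := q_spec n.
  have le_F : (D * (q n).+1 * E <= n)%N.
    have c_gt0 : (0 < 2 ^ h.+1)%N by rewrite expn_gt0.
    have := linear_le_square _ (q n).-1 _ le_n; rewrite /F.
    set c := (2 ^ h.+1)%N in le_q c_gt0.
    move=> /(_ ltac:(nia)); apply: leq_trans.
    (* [(q n).+1 <= (q n).-1 + 2] holds even for [q n = 0]. *)
    by rewrite mulnAC leq_mul2l; case: (q n) => [|r]; lia.
  rewrite ger0_norm ?ler0n // -ler_pdivrMl //.
  apply: le_trans (_ : E%:R * (D * (q n).+1)%:R <= _).
    by rewrite ler_wpM2r ?ler0n ?ltW.
  by rewrite -natrM ler_nat mulnC.
have [le_n le_q] := q_spec n.
exists (q n * q n * (9 * a - 4) + 6 * q n + 2 ^ h.+2 + 3)%N; split.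
  exact: size_THR.
(* Each grid cell serves [2 * a] inputs and costs [9 * a - 4] gates. *)
have ->: 9%:R / 2%:R - 2%:R ^- h.+1 * 4%:R = (9 * a - 4)%:R / (2 * a)%:R :> rat.
  have a_neq0 : a%:R != 0 :> rat by rewrite pnatr_eq0 -lt0n.
  rewrite -natrX expnS -/a natrB ?natrM; last by lia.
  by field.
rewrite -(ler_pM2r (_ : 0 < (2 * a)%:R)) ?ltr0n ?muln_gt0 //.
rewrite mulrDl mulrAC divfK ?pnatr_eq0 ?muln_eq0 -?lt0n //.
rewrite -!natrM -natrD ler_nat.
move: le_q; rewrite !expnS -/a; case: (q n) => [|r] /= le_q; nia.
Qed.
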